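(* Let $\mathbb{K}$ be a field, $n,d\ge1$ and $k\ge0$ integers. If $k>d(n-1)-n$, then the Veronese module $S_{n,d,k}$ has a pseudo-linear resolution over $R$.
   Context: $S=\mathbb{K}[x_1,\dots,x_n]=\bigoplus_{j\ge0}S_j$ with the standard grading, and $S_{n,d,k}=\bigoplus_{i\ge0}S_{k+id}$. $\mathcal{A}=\{\mathbf{a}\in\mathbb{N}^n:\sum_i a_i=d\}=\{\mathbf{a}_1,\dots,\mathbf{a}_N\}$ with $N=\binom{d+n-1}{d}$. $R=\mathbb{K}[y_1,\dots,y_N]$, with $\deg y_i=d$, acts on $S_{n,d,k}$ via $y_i\mapsto\mathbf{x}^{\mathbf{a}_i}$; elements of $S_{k+id}$ have degree $k+id$. $\beta_{i,j}(M)=\dim_{\mathbb{K}}\operatorname{Tor}_i^R(M,\mathbb{K})_j$ and $\beta_i(M)=\sum_j\beta_{i,j}(M)$. The minimal graded free resolution is pure if for each $i$ all generators of the $i$-th free module have the same degree $d_i$ (with $d_i<d_{i+1}$). $S_{n,d,k}$ has a pseudo-linear resolution if its minimal graded free resolution over $R$ is pure and, in addition, $\beta_i(S_{n,d,k})=\beta_{i,k+id}(S_{n,d,k})$ for all $i$. *)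

(* Defs.v *)
From HB Require Import structures.
From mathcomp Require Import all_boot all_order all_algebra.
From mathcomp Require Import mpoly.

Set Implicit Arguments.
Unset Strict Implicit.
Unset Printing Implicit Defensive.

Import GRing.Theory.

Local Open Scope ring_scope.

Section GradedResolutions.
Variables (K : fieldType) (N d : nat).
Notation R := {mpoly K[N]}.

(* The element v of the graded free module \bigoplus_l R(- sh l) is homogeneous
   of degree j, for the grading of R in which every variable has degree d.      *)
Definition free_homog (b : nat) (sh : 'I_b -> nat) (j : nat) (v : 'rV[R]_b) :=
  forall l (m : 'X_{1..N}), m \in msupp (v 0 l) -> (d * mdeg m + sh l)%N = j.

Variables (M : lmodType R) (gr : nat -> pred M).

(* ... -> F_1 -> F_0 -> M, with F_i = \bigoplus_(l < rk i) R(- sh i l).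
   Elements of F_i are row vectors; the differential F_i+1 -> F_i is
   v |-> v *m diff i.                                                           *)
Record augmented_complex := AugmentedComplex {
  rk : nat -> nat;
  sh : forall i, 'I_(rk i) -> nat;
  diff : forall i, 'M[R]_(rk i.+1, rk i);
  aug : {linear 'rV[R]_(rk 0) -> M}
}.

Definition graded (F : augmented_complex) :=
  (forall l, gr (sh l) (aug F (delta_mx 0 l))) /\
  (forall i l, free_homog (@sh F i) (sh l) (row l (diff F i))).

Definition acyclic (F : augmented_complex) :=
  [/\ forall x : M, exists v, aug F v = x,
      forall v, aug F v = 0 <-> exists w, v = w *m diff F 0
    & forall i (v : 'rV_(rk F i.+1)),
        v *m diff F i = 0 <-> exists w, v = w *m diff F i.+1].

Definition graded_free_resolution F := graded F /\ acyclic F.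

(* The image of each differential lies in (y_1, ..., y_N) F_i. *)
Definition minimal (F : augmented_complex) :=
  forall i l l', (diff F i l l')@_0%MM = 0.

Definition minimal_graded_free_resolution F :=
  graded_free_resolution F /\ minimal F.

Definition pure (F : augmented_complex) :=
  exists dg : nat -> nat,
    (forall i (l : 'I_(rk F i)), sh l = dg i) /\ (forall i, (dg i < dg i.+1)%N).

(* The complex F \otimes_R K, where K = R / (y_1, ..., y_N); its i-th term is
   'rV[K]_(rk F i), whose l-th basis vector has degree sh l.                    *)
Definition tens (F : augmented_complex) i : 'M[K]_(rk F i.+1, rk F i) :=
  map_mx (mcoeff 0%MM) (diff F i).

Definition tens_cycles (F : augmented_complex) i : 'M[K]_(rk F i) :=
  if i is i'.+1 then kermx (tens F i') else 1%:M.

Definition degree_part (F : augmented_complex) i (j : nat) : 'M[K]_(rk F i) :=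
  diag_mx (\row_l (sh l == j)%:R).

(* dim_K Tor_i(M, K)_j, as the dimension of H_i(F \otimes_R K)_j, for F a
   graded free resolution of M.                                                 *)
Definition betti (F : augmented_complex) i j : nat :=
  (\rank (tens_cycles F i :&: degree_part F i j)%MS
   - \rank (tens F i :&: degree_part F i j)%MS)%N.

(* Since F_i has finite rank, betti F i j = 0 for j > max_l (sh l), so this is
   the sum over all j.                                                          *)
Definition total_betti (F : augmented_complex) i : nat :=
  \sum_(j < (\max_(l < rk F i) sh l).+1) betti F i j.

(* Minimal graded free resolutions are unique, and Tor independent of the
   resolution, up to isomorphism; rather than fixing one choice, purity is asked
   of every minimal resolution and the condition on Betti numbers is asked of
   every resolution that may be used to compute Tor.                            *)
Definition has_pseudo_linear_resolution (k : nat) :=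
  [/\ exists F, minimal_graded_free_resolution F,
      forall F, minimal_graded_free_resolution F -> pure F
    & forall F, graded_free_resolution F ->
        forall i, total_betti F i = betti F i (k + i * d)].

End GradedResolutions.

Section Veronese.
Variables (K : fieldType) (n d k : nat).

Definition exponents : {set 'X_{1..n < d.+1}} :=
  [set a : 'X_{1..n < d.+1} | mdeg a == d].

Definition nvars : nat := #|exponents|.

Lemma nvarsE : (0 < n)%N -> nvars = 'C(d + n - 1, d).
Proof.
rewrite /nvars /exponents; case: n => // n' _.
rewrite addnS subn1 /= -size_basis cardE.
rewrite -(size_map (@bmnm n'.+1 d.+1)); apply/eqP.
rewrite -uniq_size_uniq ?uniq_basis //.
  by rewrite map_inj_uniq ?enum_uniq //; apply: val_inj.
move=> m; rewrite -basis_cover; apply/idP/mapP => [/eqP dm|[a]].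
  have lt_m : (mdeg m < d.+1)%N by rewrite dm.
  by exists (BMultinom lt_m); rewrite // mem_enum inE /= dm.
by rewrite mem_enum inE => ? ->.
Qed.

Definition exponent (i : 'I_nvars) : 'X_{1..n} := bmnm (enum_val i).

Definition veronese_map (r : {mpoly K[nvars]}) : {mpoly K[n]} :=
  r \mPo [tuple 'X_[exponent i] | i < nvars].

(* \bigoplus_i S_(k + i d), as a subset of S. *)
Definition veronese_pred : {pred {mpoly K[n]}} :=
  fun p => all (fun m => (k <= mdeg m)%N && (d %| mdeg m - k)%N) (msupp p).

Fact veronese_zmod_closed : zmod_closed veronese_pred.
Proof.
split=> [|p q /allP hp /allP hq]; first by rewrite unfold_in msupp0.
apply/allP => m /msuppB_le; rewrite mem_cat => /orP[/hp|/hq] //.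
Qed.

HB.instance Definition _ :=
  GRing.isZmodClosed.Build {mpoly K[n]} veronese_pred veronese_zmod_closed.

Record veronese :=
  Veronese { mpoly_of_veronese :> {mpoly K[n]}; _ : mpoly_of_veronese \in veronese_pred }.

HB.instance Definition _ := [isSub for mpoly_of_veronese].
HB.instance Definition _ := [Choice of veronese by <:].
HB.instance Definition _ := [SubChoice_isSubZmodule of veronese by <:].

Fact veronese_map_supp r m : m \in msupp (veronese_map r) -> (d %| mdeg m)%N.
Proof.
rewrite /veronese_map comp_mpolyEX => /msupp_sum_le /flattenP[s].
case/mapP=> u _ -> /msuppZ_le; rewrite comp_mpolyX.
under eq_bigr => i _ do rewrite tnth_mktuple.
rewrite mprodXnE msuppX inE => /eqP->.
rewrite (big_morph _ (@mdegD n) (@mdeg0 n)); apply: dvdn_sum => i _; rewrite mdegMn dvdn_mulr //.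
by have := enum_valP i; rewrite inE => /eqP->.
Qed.

Fact veronese_scale_subproof r (p : veronese) :
  veronese_map r * mpoly_of_veronese p \in veronese_pred.
Proof.
apply/allP => m /msuppM_le /allpairsP[[u v] /= [/veronese_map_supp du hv ->]].
have /allP/(_ _ hv)/andP[kv dv] := valP p.
by rewrite mdegD (leq_trans kv) ?leq_addl //= -addnBA // dvdn_add.
Qed.

(* y_i acts as multiplication by x^(a_i). *)
Definition veronese_scale (r : {mpoly K[nvars]}) (p : veronese) : veronese :=
  Veronese (veronese_scale_subproof r p).

Fact veronese_scaleA r s p :
  veronese_scale r (veronese_scale s p) = veronese_scale (r * s) p.
Proof. by apply: val_inj; rewrite /= /veronese_map rmorphM mulrA. Qed.

Fact veronese_scale1 : left_id 1 veronese_scale.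
Proof. by move=> p; apply: val_inj; rewrite /= /veronese_map rmorph1 mul1r. Qed.

Fact veronese_scaleDr : right_distributive veronese_scale +%R.
Proof. by move=> r p q; apply: val_inj; rewrite /= mulrDr. Qed.

Fact veronese_scaleDl p : {morph veronese_scale^~ p : r s / r + s}.
Proof.
by move=> r s; apply: val_inj; rewrite /= /veronese_map rmorphD mulrDl.
Qed.

HB.instance Definition _ :=
  GRing.Zmodule_isLmodule.Build {mpoly K[nvars]} veronese
    veronese_scaleA veronese_scale1 veronese_scaleDr veronese_scaleDl.

Definition veronese_grading (j : nat) : pred veronese :=
  fun p => mpoly_of_veronese p \is j.-homog.

End Veronese.

(* Main.v *)
Require Import Defs.
From HB Require Import structures.
From mathcomp Require Import all_boot all_order all_algebra.
From mathcomp Require Import mpoly zify.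
From Stdlib Require Import Classical IndefiniteDescription.

(* S is multigraded and the pure powers x_a^d form a regular sequence on it, so
   their Koszul cycles with coefficients in S are boundaries up to monomials
   divisible by no x_a^d; such monomials have degree at most n(d - 1) < k + d.
   Hence the Koszul homology of the pure powers on S_{n,d,k} comes from
   coefficients of degree k only. Mapping cones preserve this when the other
   variables are added, so Tor_i(S_{n,d,k}, K) lives in degree k + i d.

   Koszul homology is shifted by one along 0 -> Z -> F -> V -> 0 with F graded
   free, so every syzygy module of every graded free resolution inherits the
   property: its elements lying in (y)F and having no component on the expected
   strand already lie in (y)Z. This gives the Betti numbers of all resolutions,
   and builds a minimal one by choosing bases of the strands.               *)

Set Implicit Arguments.
Unset Strict Implicit.
Unset Printing Implicit Defensive.

Import GRing.Theory.

Local Open Scope ring_scope.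

(** * Gradings expressed by predicates on sets of degrees *)

Section GradedModule.
Variables (K : fieldType) (N d : nat) (V : lmodType {mpoly K[N]}).

(* [P D v] stands for: all homogeneous components of [v] have degree in [D]. *)
Record graded_module (P : (nat -> bool) -> V -> Prop) : Prop := GradedModule {
  gm0 : forall D, P D 0;
  gmB : forall D u v, P D u -> P D v -> P D (u - v);
  gmX : forall D i v, P (fun n => D (n + d)%N) v -> P D ('X_i *: v);
  gmC : forall D c v, P D v -> P D (c%:MP *: v);
  gm_split : forall D E v, P D v -> exists u w,
    [/\ v = u + w, P (fun n => D n && E n) u & P (fun n => D n && ~~ E n) w];
  gm_disj : forall D v, P D v -> P (fun n => ~~ D n) v -> v = 0;
  gm_bound : forall D v, P D v -> exists b, P (fun n => D n && (n < b)%N) v;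
  gm_sub : forall (D E : nat -> bool) v, (forall n, D n -> E n) -> P D v -> P E v }.

Variables (P : (nat -> bool) -> V -> Prop) (gP : graded_module P).

Lemma gmN D v : P D v -> P D (- v).
Proof. by rewrite -sub0r; apply: (gmB gP); apply: (gm0 gP). Qed.

Lemma gmD D u v : P D u -> P D v -> P D (u + v).
Proof. by move=> Pu /gmN; rewrite -{2}[v]opprK; apply: (gmB gP). Qed.

End GradedModule.

(** * Koszul complexes as iterated mapping cones *)

Section Koszul.
Variables (K : fieldType) (N : nat).
Notation R := {mpoly K[N]}.

(* The total Koszul complex of the variables in [s] with coefficients in [V],
   as an iterated mapping cone; the homological degree is not recorded.      *)
Fixpoint kos (V : lmodType R) (s : seq 'I_N) : lmodType R :=
  if s is _ :: s' then (kos V s' * kos V s')%type else V.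

(** A pair [(a, b)] over [i :: s'] stands for a + e_i b, with the sign rule d(e_i b) = X_i b - e_i
    d(b). *)
Fixpoint kd (V : lmodType R) s : kos V s -> kos V s :=
  match s return kos V s -> kos V s with
  | [::] => fun=> 0
  | i :: s' => fun c => (kd c.1 + 'X_i *: c.2, - kd c.2)
  end.

Fixpoint kbase (V : lmodType R) s : V -> kos V s :=
  match s return V -> kos V s with
  | [::] => id
  | i :: s' => fun v => (kbase s' v, 0)
  end.

(** Projection onto homological degree 0, where [kbase] is the inclusion. It is not a chain map. *)
Fixpoint keps (V : lmodType R) s : kos V s -> V :=
  match s return kos V s -> V with
  | [::] => id
  | i :: s' => fun c => keps c.1
  end.

(** The exterior generators carry no degree here, so [kd] raises coefficient degrees by [d]; this is
    the shift of [D] seen in all later statements about boundaries. *)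
Fixpoint kall (V : lmodType R) (Q : V -> Prop) s : kos V s -> Prop :=
  match s return kos V s -> Prop with
  | [::] => Q
  | i :: s' => fun c => kall Q c.1 /\ kall Q c.2
  end.

Fixpoint kmap (V W : lmodType R) (f : V -> W) s : kos V s -> kos W s :=
  match s return kos V s -> kos W s with
  | [::] => f
  | i :: s' => fun c => (kmap f c.1, kmap f c.2)
  end.

Section OneModule.
Variable V : lmodType R.
Implicit Types (s : seq 'I_N) (v : V) (Q : V -> Prop).

Lemma kdB s (c c' : kos V s) : kd (c - c') = kd c - kd c'.
Proof.
elim: s c c' => [|i s IHs] /= c c'; first by rewrite subr0.
apply: (f_equal2 pair) => /=; rewrite IHs; last by rewrite opprD.
by rewrite scalerBr opprD addrACA.
Qed.

Lemma kd0 s : kd (0 : kos V s) = 0.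
Proof. by have := kdB (0 : kos V s) 0; rewrite !subrr. Qed.

Lemma kdN s (c : kos V s) : kd (- c) = - kd c.
Proof. by rewrite -sub0r kdB kd0 sub0r. Qed.

Lemma kdD s (c c' : kos V s) : kd (c + c') = kd c + kd c'.
Proof. by rewrite -{1}[c']opprK kdB kdN opprK. Qed.

Lemma kdZ s r (c : kos V s) : kd (r *: c) = r *: kd c.
Proof.
elim: s c => [|i s IHs] c /=; first by rewrite scaler0.
apply: (f_equal2 pair) => /=; rewrite IHs; last by rewrite scalerN.
by rewrite scalerDr !scalerA mulrC.
Qed.

Lemma kdK s (c : kos V s) : kd (kd c) = 0.
Proof.
elim: s c => [|i s IHs] c //=.
apply: (f_equal2 pair) => /=; last by rewrite kdN IHs !oppr0.
by rewrite kdD kdZ IHs add0r scalerN subrr.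
Qed.

Lemma kbaseB s u v : kbase s (u - v) = kbase s u - kbase s v.
Proof.
elim: s => [|i s IHs] //=.
by apply: (f_equal2 pair) => /=; rewrite ?IHs ?subr0.
Qed.

Lemma kbase0 s : kbase s (0 : V) = 0.
Proof. by have := kbaseB s 0 0; rewrite !subrr. Qed.

Lemma kbaseD s u v : kbase s (u + v) = kbase s u + kbase s v.
Proof.
elim: s => [|i s IHs] //=.
by apply: (f_equal2 pair) => /=; rewrite ?IHs ?addr0.
Qed.

Lemma kbaseZ s r v : kbase s (r *: v) = r *: kbase s v.
Proof.
elim: s => [|i s IHs] //=.
by apply: (f_equal2 pair) => /=; rewrite ?IHs ?scaler0.
Qed.

Lemma kd_base s v : kd (kbase s v) = 0.
Proof.
elim: s => [|i s IHs] //=.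
apply: (f_equal2 pair) => /=; first by rewrite IHs scaler0 addr0.
by rewrite kd0 oppr0.
Qed.

Lemma kbaseK s : cancel (kbase s) (@keps V s).
Proof. by elim: s => [|i s IHs]. Qed.

Lemma kepsN s (c : kos V s) : keps (- c) = - keps c.
Proof. by elim: s c => [|i s IHs] c //=; rewrite IHs. Qed.

Lemma kepsD s (c c' : kos V s) : keps (c + c') = keps c + keps c'.
Proof. by elim: s c c' => [|i s IHs] c c' //=; rewrite IHs. Qed.

Lemma kepsZ s r (c : kos V s) : keps (r *: c) = r *: keps c.
Proof. by elim: s c => [|i s IHs] c //=; rewrite IHs. Qed.

Lemma kall_eps Q s (c : kos V s) : kall Q c -> Q (keps c).
Proof. by elim: s c => [|i s IHs] c //= [/IHs]. Qed.

Lemma kall_imp Q Q' s (c : kos V s) :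
  (forall v, Q v -> Q' v) -> kall Q c -> kall Q' c.
Proof.
by move=> QQ'; elim: s c => [|i s IHs] c /=; [apply: QQ'|case=> /IHs ? /IHs].
Qed.

Lemma kall_base Q s v : Q 0 -> Q v -> kall Q (kbase s v).
Proof.
move=> Q0 Qv; have Qk0 s' : kall Q (0 : kos V s').
  by elim: s' => //= i s' IHs.
by elim: s => [|i s IHs] //=.
Qed.

(** Only the part of the chain in homological degree 1 reaches degree 0, and [w i] is its
    coefficient at e_i. *)
Lemma keps_kd Q s (c : kos V s) : Q 0 -> uniq s -> kall Q c ->
  exists w, (forall i, Q (w i)) /\ keps (kd c) = \sum_(i <- s) 'X_i *: w i.
Proof.
move=> Q0; elim: s c => [|i s IHs] /= c.
  by exists (fun=> 0); rewrite big_nil.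
case/andP=> i_s us [Qa Qb]; have [w [Qw ew]] := IHs c.1 us Qa.
exists (fun j => if j == i then keps c.2 else w j); split.
  by move=> j; case: ifP => // _; apply: kall_eps.
rewrite kepsD kepsZ ew big_cons eqxx addrC; congr (_ + _).
by apply: eq_big_seq => j js; case: eqP => // ji; rewrite -ji js in i_s.
Qed.

Variables (d : nat) (P : (nat -> bool) -> V -> Prop).
Hypothesis gP : graded_module d P.

Lemma kallB D s (c c' : kos V s) :
  kall (P D) c -> kall (P D) c' -> kall (P D) (c - c').
Proof.
elim: s c c' => [|i s IHs] c c' /=; first exact: (gmB gP).
by case=> ca cb [ca' cb']; split; [apply: IHs ca ca' | apply: IHs cb cb'].
Qed.

Lemma kallD D s (c c' : kos V s) :
  kall (P D) c -> kall (P D) c' -> kall (P D) (c + c').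
Proof.
elim: s c c' => [|i s IHs] c c' /=; first exact: (gmD gP).
by case=> ca cb [ca' cb']; split; [apply: IHs ca ca' | apply: IHs cb cb'].
Qed.

Lemma kallN D s (c : kos V s) : kall (P D) c -> kall (P D) (- c).
Proof.
elim: s c => [|i s IHs] c /=; first exact: (gmN gP).
by case=> ? ?; split; apply: IHs.
Qed.

Lemma kallX D s i (c : kos V s) :
  kall (P (fun n => D (n + d)%N)) c -> kall (P D) ('X_i *: c).
Proof.
elim: s c => [|j s IHs] c /=; first exact: (gmX gP).
by case=> ? ?; split; apply: IHs.
Qed.

Lemma kall_kd D s (c : kos V s) :
  kall (P (fun n => D (n + d)%N)) c -> kall (P D) (kd c).
Proof.
elim: s c => [|i s IHs] c /=; first by move=> _; apply: (gm0 gP).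
by case=> ? ?; split; [apply: kallD; [apply: IHs | apply: kallX]
  | apply/kallN/IHs].
Qed.

(* If the elements of [Red s] represent V modulo the variables in [s], and every
   further variable in [A] is a nonzerodivisor on that quotient, then the Koszul
   homology of [s] is concentrated in homological degree 0.                     *)
Lemma koszul_regular (A : pred 'I_N) (Red : seq 'I_N -> V -> Prop) D :
    (forall v, Red [::] v) ->
    (forall i s v, A i -> P D v -> Red s v -> exists u w,
      [/\ v = u + 'X_i *: w, P D u, Red (i :: s) u
        & P (fun n => D (n + d)%N) w]) ->
    (forall i s v w, A i -> all A s -> i \notin s -> Red s v ->
      'X_i *: v = \sum_(j <- s) 'X_j *: w j -> v = 0) ->
  forall s (c : kos V s), uniq s -> all A s -> kall (P D) c -> kd c = 0 ->
  exists c' v, [/\ kall (P (fun n => D (n + d)%N)) c', P D v, Red s v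
                 & c = kd c' + kbase s v].
Proof.
move=> Red0 RedX regX; elim=> [|i s IHs] /= c.
  by exists 0, c; split=> //; [apply: (gm0 gP) | rewrite add0r].
case: c => a b /= /andP[i_s us] /andP[Ai As] [Pa Pb] [da /eqP].
rewrite oppr_eq0 => /eqP/(IHs b us As Pb)[b' [e [Pb' Pe Re def_b]]].
have da' : kd (a + 'X_i *: b') = - ('X_i *: kbase s e).
  move: da; rewrite kdD kdZ def_b scalerDr addrA => /eqP.
  by rewrite addr_eq0 => /eqP.
(* The degree 0 part of [da'] puts X_i e into the submodule generated by the variables of [s], so
   regularity of X_i applies. *)
have e0 : e = 0.
  have [w [_ ew]] := @keps_kd (fun=> True) s (a + 'X_i *: b') I us
    (kall_imp (Q := P D) (fun _ _ => I) (kallD Pa (kallX i Pb'))).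
  apply: (regX i s e (fun j => - w j)) => //.
  under eq_bigr do rewrite scalerN.
  by rewrite sumrN -ew da' -kbaseZ kepsN kbaseK opprK.
rewrite e0 kbase0 addr0 in def_b; rewrite e0 kbase0 scaler0 oppr0 in da'.
have [a' [f [Pa' Pf Rf def_a]]] := IHs _ us As (kallD Pa (kallX i Pb')) da'.
have [f1 [g [def_f Pf1 Rf1 Pg]]] := RedX i s f Ai Pf Rf.
(* The term X_i g of [f] is the boundary contributed by [g] in the second slot, which leaves only
   the reduced [f1]; [- b'] restores [b] and turns a + X_i b' back into [a]. *)
exists (a', kbase s g - b'), f1; split=> //=.
  by split=> //; apply: kallB => //; apply: kall_base => //; apply: (gm0 gP).
congr pair; rewrite /= ?addr0.
  rewrite scalerBr -kbaseZ addrAC -!addrA [kbase _ _ + (_ - _)]addrA.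
  by rewrite -kbaseD -def_f !addrA -def_a addrK.
by rewrite kdB kd_base sub0r opprK.
Qed.

End OneModule.

Lemma kmapB (V W : lmodType R) (f : {linear V -> W}) s (c c' : kos V s) :
  kmap f (c - c') = kmap f c - kmap f c'.
Proof.
elim: s c c' => [|i s IHs] c c' /=; first exact: raddfB.
by rewrite !IHs.
Qed.

Lemma kmapZ (V W : lmodType R) (f : {linear V -> W}) s r (c : kos V s) :
  kmap f (r *: c) = r *: kmap f c.
Proof.
elim: s c => [|i s IHs] c /=; first exact: linearZ.
by rewrite !IHs.
Qed.

Lemma kmap0 (V W : lmodType R) (f : {linear V -> W}) s :
  kmap f (0 : kos V s) = 0.
Proof. by have := kmapB f (0 : kos V s) 0; rewrite !subrr. Qed.

Lemma kmapN (V W : lmodType R) (f : {linear V -> W}) s (c : kos V s) :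
  kmap f (- c) = - kmap f c.
Proof. by rewrite -sub0r kmapB kmap0 sub0r. Qed.

Lemma kmapD (V W : lmodType R) (f : {linear V -> W}) s (c c' : kos V s) :
  kmap f (c + c') = kmap f c + kmap f c'.
Proof. by rewrite -{1}[c']opprK kmapB kmapN opprK. Qed.

Lemma kmap_kd (V W : lmodType R) (f : {linear V -> W}) s (c : kos V s) :
  kmap f (kd c) = kd (kmap f c).
Proof.
elim: s c => [|i s IHs] c /=; first exact: raddf0.
by rewrite kmapD kmapZ kmapN !IHs.
Qed.

Lemma keps_map (V W : lmodType R) (f : V -> W) s (c : kos V s) :
  keps (kmap f c) = f (keps c).
Proof. by elim: s c => [|i s IHs] c //=. Qed.

Lemma kall_map (V W : lmodType R) (f : V -> W) (Q : W -> Prop) s (c : kos V s) :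
  kall Q (kmap f c) <-> kall (fun v => Q (f v)) c.
Proof.
elim: s c => [|i s IHs] c //=.
by split=> [][/IHs ? /IHs].
Qed.

(** Chains with coefficients in the kernel of [f] are thus handled inside [kos V s], without making
    the kernel a module of its own. *)
Lemma kall_ker (V W : lmodType R) (f : V -> W) (Q : V -> Prop) s (c : kos V s) :
  kall (fun v => Q v /\ f v = 0) c <-> kall Q c /\ kmap f c = 0.
Proof.
elim: s c => [|i s IHs] //= [a b] /=.
split=> [[/IHs[? fa] /IHs[? fb]]|[[Qa Qb] [fa fb]]]; last by split; apply/IHs.
by rewrite fa fb.
Qed.

Lemma kall_lift (V W : lmodType R) (f : V -> W) (Q : V -> Prop) (Q' : W -> Prop) s
    (c : kos W s) :
  (forall w, Q' w -> exists2 v, Q v & w = f v) -> kall Q' c ->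
  exists2 c', kall Q c' & c = kmap f c'.
Proof.
move=> lift; elim: s c => [|i s IHs] c /=; first exact: lift.
case: c => a b /= [/IHs[a' Qa ea] /IHs[b' Qb eb]].
by exists (a', b'); rewrite //= ea eb.
Qed.

End Koszul.

(** * Termwise division of polynomials by monomials *)

Section MonomialTools.
Variables (K : fieldType) (n : nat).
Implicit Types (p : {mpoly K[n]}) (m : 'X_{1..n}) (A : pred 'X_{1..n}).

Definition mfilter A p := \sum_(m <- msupp p | A m) p@_m *: 'X_[m].

Lemma mcoeff_filter A p m : (mfilter A p)@_m = if A m then p@_m else 0.
Proof.
rewrite raddf_sum /=; have [pm|] := boolP (m \in msupp p); last first.
  move=> pm; rewrite (memN_msupp_eq0 pm) if_same big_seq_cond big1 // => m'.
  rewrite mcoeffZ mcoeffX; case: eqP => [->|_]; last by rewrite mulr0.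
  by rewrite (negPf pm).
rewrite big_mkcond (bigD1_seq m) ?msupp_uniq //= big1 ?addr0 => [|m' nm].
  by case: ifP => // _; rewrite mcoeffZ mcoeffX eqxx mulr1.
by case: ifP => // _; rewrite mcoeffZ mcoeffX (negPf nm) mulr0.
Qed.

Lemma msupp_filter A p m : (m \in msupp (mfilter A p)) = A m && (m \in msupp p).
Proof. by rewrite !mcoeff_msupp mcoeff_filter; case: (A m); rewrite ?eqxx. Qed.

Lemma mcoeffXM m0 p m :
  ('X_[m0] * p)@_m = if (m0 <= m)%MM then p@_(m - m0) else 0.
Proof.
rewrite mulrC; case: ifP => [le_m|nle].
  by rewrite -{1}(submK le_m) addmC mcoeffMX.
apply/eqP; rewrite mcoeff_eq0 (perm_mem (msuppMX _ _)).
by apply/mapP => -[m' _ em]; rewrite em lem_addr in nle.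
Qed.

Definition mquo m0 p := \sum_(m <- msupp p | (m0 <= m)%MM) p@_m *: 'X_[m - m0].

Lemma mquoE m0 p : p = mfilter (fun m => ~~ (m0 <= m)%MM) p + 'X_[m0] * mquo m0 p.
Proof.
have -> : 'X_[m0] * mquo m0 p = mfilter (fun m => (m0 <= m)%MM) p.
  rewrite /mquo /mfilter mulr_sumr; apply: eq_bigr => m le_m.
  by rewrite -scalerAr -mpolyXD addmC submK.
apply/mpolyP => m; rewrite mcoeffD !mcoeff_filter.
by case: (m0 <= m)%MM; rewrite ?addr0 ?add0r.
Qed.

Lemma msupp_quo m0 p m : m \in msupp (mquo m0 p) -> (m0 + m)%MM \in msupp p.
Proof.
rewrite !mcoeff_msupp {2}[p](mquoE m0) mcoeffD mcoeff_filter lem_addr add0r.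
by rewrite mcoeffXM lem_addr [(m0 + m)%MM]addmC addmK.
Qed.

(** Compare coefficients at ex i + m for m in the support of [p]: a nonzero one on the right needs
    some ex j dividing ex i + m, hence dividing m, which is excluded. *)
Lemma mpolyX_regular (I : eqType) (ex : I -> 'X_{1..n}) i (s : seq I) p w :
    {in s, forall j m, (ex j <= ex i + m)%MM -> (ex j <= m)%MM} ->
    {in msupp p, forall m, {in s, forall j, ~~ (ex j <= m)%MM}} ->
  'X_[ex i] * p = \sum_(j <- s) 'X_[ex j] * w j -> p = 0.
Proof.
move=> orth red def_p; apply/mpolyP => m; rewrite mcoeff0.
have [pm|/memN_msupp_eq0//] := boolP (m \in msupp p).
have /(congr1 (mcoeff (ex i + m))) := def_p.
rewrite mcoeffXM lem_addr addmC addmK => ->.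
rewrite raddf_sum /= big_seq big1 // => j js; rewrite mcoeffXM addmC.
by case: ifP => // /(orth j js); rewrite (negPf (red m pm j js)).
Qed.

End MonomialTools.

(** * Koszul homology concentrated on a strand *)

Section Strand.
Variables (K : fieldType) (N d : nat).
Notation R := {mpoly K[N]}.

(* Among the cycles whose augmentation is in [Q], the Koszul homology is carried
   by coefficients of degree [t]: for [Q] total this says that Tor_i(V, K) lives
   in degree t + i d.                                                          *)
Definition on_strand (V : lmodType R) (P : (nat -> bool) -> V -> Prop)
    (Q : V -> Prop) (s : seq 'I_N) (t : nat) :=
  forall D, ~~ D t -> forall c : kos V s, kall (P D) c -> kd c = 0 ->
    Q (keps c) -> exists2 c', kall (P (fun n => D (n + d)%N)) c' & c = kd c'.

Section AddVariables.
Variables (V : lmodType R) (P : (nat -> bool) -> V -> Prop).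
Hypothesis gP : graded_module d P.

(** The new complex is the mapping cone of X_i. A primitive [b'] of the second component makes a +
    X_i b' a cycle, whose own primitive completes the pair; both primitives have the same
    coefficient degrees, so [t] does not move. *)
Lemma on_strand_cons t i s :
  on_strand P (fun=> True) s t -> on_strand P (fun=> True) (i :: s) t.
Proof.
move=> strS D Dt [a b] /= [Pa Pb] [da /eqP]; rewrite oppr_eq0 => /eqP db _.
have [b' Pb' def_b] := strS D Dt b Pb db I.
have da' : kd (a + 'X_i *: b') = 0 by rewrite kdD kdZ -def_b.
have [a' Pa' def_a] := strS D Dt _ (kallD gP Pa (kallX gP i Pb')) da' I.
exists (a', - b') => /=; first by split=> //; apply: (kallN gP).
by rewrite kdN opprK -def_b -def_a scalerN addrK.
Qed.

Lemma on_strand_cat t s' s :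
  on_strand P (fun=> True) s t -> on_strand P (fun=> True) (s' ++ s) t.
Proof. by move=> strS; elim: s' => //= i s' IHs; apply: on_strand_cons. Qed.

End AddVariables.

(** In homological degree 0 every element is a cycle, and being a boundary there means lying in the
    submodule generated by the variables. *)
Lemma on_strand_generated (V : lmodType R) (P : (nat -> bool) -> V -> Prop)
    Q s t D v :
    (forall D, P D 0) -> uniq s -> on_strand P Q s t ->
    ~~ D t -> P D v -> Q v ->
  exists w, (forall i, P (fun n => D (n + d)%N) (w i)) /\
            v = \sum_(i <- s) 'X_i *: w i.
Proof.
move=> P0 us strS Dt Pv Qv.
have := strS D Dt (kbase s v) (kall_base s (P0 D) Pv) (kd_base s v).
rewrite kbaseK => /(_ Qv)[c Pc def_v].
have [w [Pw ew]] := keps_kd (P0 _) us Pc.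
by exists w; rewrite -[v](kbaseK s) def_v ew.
Qed.

(** * Free modules and dimension shifting *)

Section FreeModule.
Variables (b : nat) (sh : 'I_b -> nat).
Implicit Types (v : 'rV[R]_b).

Definition fhomog (D : nat -> bool) v :=
  forall l m, m \in msupp (v 0 l) -> D (d * mdeg m + sh l)%N.

(** Membership in (y_1, ..., y_N)F, read off the constant terms. *)
Definition in_max v := forall l, (v 0 l)@_0%MM = 0.

Lemma in_max0 : in_max 0.
Proof. by move=> l; rewrite mxE mcoeff0. Qed.

Lemma graded_free : graded_module d fhomog.
Proof.
split=> [D l m|D u v hu hv l m|D i v hv l m|D c v hv l m|D E v hv|D v hv hv'
  |D v hv|D E v DE hv l m].
- by rewrite mxE msupp0.
- by rewrite !mxE => /msuppB_le; rewrite mem_cat => /orP[/hu|/hv].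
- rewrite mxE mulrC (perm_mem (msuppMX _ _)) => /mapP[m' /hv Dm ->].
  by rewrite mdegD mdeg1 mulnDr muln1 -addnA addnC.
- by rewrite mxE mul_mpolyC => /msuppZ_le/hv.
- pose f A : 'rV[R]_b := \row_l mfilter (fun m => A (d * mdeg m + sh l)%N) (v 0 l).
  exists (f E), (f (predC E)); split=> [|l m|l m].
  + apply/rowP => l; rewrite !mxE; apply/mpolyP => m.
    by rewrite mcoeffD !mcoeff_filter /=; case: (E _); rewrite ?addr0 ?add0r.
  + by rewrite mxE msupp_filter => /andP[-> /hv ->].
  + by rewrite mxE msupp_filter => /andP[/= -> /hv ->].
- apply/rowP => l; rewrite mxE; apply/mpolyP => m; rewrite mcoeff0.
  apply/eqP; rewrite mcoeff_eq0; apply/negP => vm.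
  by have := hv' l m vm; rewrite (hv l m vm).
- exists (\max_l \max_(m <- msupp (v 0%R l)) (d * mdeg m + sh l)%N).+1 => l m vm.
  rewrite (hv l m vm) ltnS.
  apply: (leq_trans _ (leq_bigmax l)) => /=.
  exact: (@leq_bigmax_seq _ _ predT (fun m : 'X_{1..N} => d * mdeg m + sh l)%N).
- by move/hv/DE.
Qed.

(** The variables form a regular sequence on F, so a cycle is a boundary up to an element of F with
    constant entries; the condition on [keps] forces these constants to vanish. *)
Lemma free_acyclic s D (c : kos 'rV[R]_b s) : uniq s -> s =i 'I_N ->
    kall (fhomog D) c -> kd c = 0 -> in_max (keps c) ->
  exists2 c', kall (fhomog (fun n => D (n + d)%N)) c' & c = kd c'.
Proof.
move=> us sT Pc dc cm.
pose Red (s : seq 'I_N) v :=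
  forall l, {in msupp (v 0 l), forall m, {in s, forall j, ~~ (U_(j) <= m)%MM}}.
have [||||c' [v [Pc' Pv Rv def_c]]] :=
  @koszul_regular _ _ _ _ _ graded_free predT Red D _ _ _ s c us _ Pc dc.
- by [].
- move=> i s' v _ Pv Rv.
  exists (\row_l mfilter (fun m => ~~ (U_(i) <= m)%MM) (v 0 l)).
  exists (\row_l mquo U_(i) (v 0 l)); split.
  + by apply/rowP => l; rewrite !mxE -mquoE.
  + by move=> l m; rewrite mxE msupp_filter => /andP[_ /Pv].
  + move=> l m; rewrite mxE msupp_filter => /andP[im vm] j.
    by rewrite inE => /predU1P[->//|js]; apply: (Rv l).
  + move=> l m; rewrite mxE => /msupp_quo/Pv.
    by rewrite mdegD mdeg1 mulnDr muln1 -addnA addnC.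
- move=> i s' v w _ _ i_s Rv def_v; apply/rowP => l; rewrite mxE.
  apply: (@mpolyX_regular _ _ _ (fun j => U_(j)%MM) i s' _ (fun j => w j 0 l)).
  + move=> j js m; rewrite !lep1mP mnmDE mnm1E.
    by have [ij|_] := eqVneq i j; first by rewrite ij js in i_s.
  + by move=> m vm j; apply: (Rv l).
  + have := congr1 (fun v : 'rV[R]_b => v 0 l) def_v; rewrite !mxE => ->.
    by rewrite summxE; apply: eq_bigr => j _; rewrite mxE.
- by rewrite all_predT.
exists c' => //; rewrite def_c; suff -> : v = 0 by rewrite kbase0 addr0.
have [w [_ ew]] := keps_kd (Q := fun=> True) I us
  (kall_imp (fun _ _ => I) Pc').
apply/rowP => l; rewrite mxE; apply/mpolyP => m; rewrite mcoeff0.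
have [vm|/memN_msupp_eq0//] := boolP (m \in msupp (v 0 l)).
(* Since [s] contains all variables, the only reduced monomial is 1. *)
have m0 : m = 0%MM.
  apply/mnmP => j; rewrite mnm0E; apply/eqP; rewrite -[_ == _]negbK -lep1mP.
  by apply: Rv vm _ _; rewrite sT.
have := cm l; rewrite def_c kepsD kbaseK ew mxE mcoeffD m0 summxE raddf_sum /=.
rewrite big1 ?add0r // => j _.
by rewrite mxE mcoeffXM lep1mP mnm0E.
Qed.

(** The connecting map of 0 -> Ker f -> F -> V -> 0, carried out on chains: a cycle in the kernel
    has a primitive in F, whose image in V is a cycle one homological degree higher. Restricting to
    [in_max] is what makes the cycle bound in F, since F/(y)F need not vanish. *)
Lemma on_strand_syzygy (V : lmodType R) (P : (nat -> bool) -> V -> Prop)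
    (f : {linear 'rV[R]_b -> V}) Q s t :
    uniq s -> s =i 'I_N -> Q 0 -> on_strand P Q s t ->
    (forall D v, fhomog D v -> P D (f v)) ->
    (forall D x, P D x -> exists2 v, fhomog D v & x = f v) ->
  on_strand (fun D v => fhomog D v /\ f v = 0) in_max s (t + d)%N.
Proof.
move=> us sT Q0 strV homf lift D Dt c Pc dc cm.
have [Fc fc] := proj1 (kall_ker f _ c) Pc.
have [c' Pc' def_c] := free_acyclic us sT Fc dc cm.
(* The augmentation of c' is killed by kd, so it can be discarded. *)
pose c1 := c' - kbase s (keps c').
have dc1 : kd c1 = c by rewrite kdB kd_base subr0.
have Pc1 : kall (fhomog (fun n => D (n + d)%N)) c1.
  apply: (kallB graded_free) => //; apply: kall_base (kall_eps Pc').
  exact: (gm0 graded_free).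
have [|||c2 Pc2 def_c2] := strV (fun n => D (n + d)%N) Dt (kmap f c1).
- by apply/kall_map; apply: kall_imp Pc1 => v /homf.
- by rewrite -kmap_kd dc1.
- by rewrite keps_map kepsD kepsN kbaseK subrr raddf0.
(* Subtracting the boundary of a lift of [c2] keeps the boundary of [c1] and moves its coefficients
   into the kernel. *)
have [c3 Pc3 def_c3] := kall_lift (lift _) Pc2.
exists (c1 - kd c3); last by rewrite kdB kdK subr0.
apply/kall_ker; split; last by rewrite kmapB kmap_kd -def_c3 -def_c2 subrr.
by apply: (kallB graded_free) => //; apply: (kall_kd graded_free).
Qed.

End FreeModule.
End Strand.

(** * The Veronese module lies on the strand of degree k *)

Section VeroneseStrand.
Variables (K : fieldType) (n d k : nat).
Notation V := (veronese K n d k).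
Notation N := (nvars n d).

Definition vhomog (D : nat -> bool) (p : V) :=
  forall m, m \in msupp (mpoly_of_veronese p) -> D (mdeg m).

Lemma mem_veronese (p : V) m : m \in msupp (mpoly_of_veronese p) ->
  (k <= mdeg m)%N /\ (d %| mdeg m - k)%N.
Proof. by move=> pm; apply/andP; apply: (allP (valP p)). Qed.

Lemma veronese_scaleX i (p : V) :
  mpoly_of_veronese ('X_i *: p) = 'X_[exponent i] * mpoly_of_veronese p.
Proof. by rewrite /= /veronese_map comp_mpolyXU -tnth_nth tnth_mktuple. Qed.

Lemma veronese_scaleC c (p : V) :
  mpoly_of_veronese (c%:MP *: p) = c *: mpoly_of_veronese p.
Proof. by rewrite /= /veronese_map comp_mpolyC mul_mpolyC. Qed.

Lemma mdeg_exponent (i : 'I_N) : mdeg (exponent i) = d.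
Proof. by have := enum_valP i; rewrite inE => /eqP. Qed.

Lemma exponent_inj : injective (@exponent n d).
Proof. by move=> i j eij; apply: enum_val_inj; apply: val_inj. Qed.

Lemma exponent_pure (a : 'I_n) : exists i : 'I_N, exponent i = (U_(a) *+ d)%MM.
Proof.
have lt_d : (mdeg (U_(a) *+ d)%MM < d.+1)%N by rewrite mdegMn mdeg1 mul1n.
have ad : BMultinom lt_d \in exponents n d by rewrite inE /= mdegMn mdeg1 mul1n.
by exists (enum_rank_in ad (BMultinom lt_d)); rewrite /exponent enum_rankK_in.
Qed.

Lemma mnm_le_pure (a : 'I_n) m : (U_(a) *+ d <= m)%MM = (d <= m a)%N.
Proof.
apply/mnm_lepP/idP => [/(_ a)|le_d b]; rewrite mulmnE mnm1E ?eqxx ?mul1n //.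
by case: eqP => [<-|]; rewrite ?mul1n ?mul0n.
Qed.

Lemma veronese_filter_subproof (A : pred 'X_{1..n}) (p : V) :
  mfilter A (mpoly_of_veronese p) \in veronese_pred d k.
Proof.
apply/allP => m; rewrite msupp_filter => /andP[_ /mem_veronese[km dm]].
by rewrite km.
Qed.

Definition veronese_filter A p : V := Veronese (veronese_filter_subproof A p).

Lemma graded_veronese : graded_module d vhomog.
Proof.
split=> [D m|D u v hu hv m|D i v hv m|D c v hv m|D E v hv|D v hv hv'
  |D v hv|D E v DE hv m].
- by rewrite /= msupp0.
- by rewrite /= => /msuppB_le; rewrite mem_cat => /orP[/hu|/hv].
- rewrite veronese_scaleX mulrC (perm_mem (msuppMX _ _)) => /mapP[m' /hv Dm ->].
  by rewrite mdegD mdeg_exponent addnC.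
- by rewrite veronese_scaleC => /msuppZ_le/hv.
- pose f A := veronese_filter (fun m => A (mdeg m)) v.
  exists (f E), (f (predC E)); split=> [|m|m].
  + apply: val_inj; apply/mpolyP => m.
    by rewrite /= mcoeffD !mcoeff_filter /=; case: (E _); rewrite ?addr0 ?add0r.
  + by rewrite msupp_filter => /andP[-> /hv ->].
  + by rewrite msupp_filter => /andP[/= -> /hv ->].
- apply: val_inj; apply/mpolyP => m; rewrite mcoeff0.
  apply/eqP; rewrite mcoeff_eq0; apply/negP => vm.
  by have := hv' m vm; rewrite (hv m vm).
- exists (\max_(m <- msupp (mpoly_of_veronese v)) mdeg m).+1 => m vm.
  by rewrite (hv m vm) ltnS (@leq_bigmax_seq _ _ predT (@mdeg n)).
- by move/hv/DE.
Qed.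

Hypotheses (d_gt0 : (0 < d)%N) (k_large : (n * d.-1 < k + d)%N).

Let pure_var : pred 'I_N := fun i => [exists a, exponent i == (U_(a) *+ d)%MM].

(* The pure powers x_a^d form a regular sequence on the polynomial ring, and a
   monomial not divisible by any of them has degree at most n(d - 1).          *)
Lemma on_strand_pure s : uniq s -> s =i pure_var ->
  on_strand d vhomog (fun=> True) s k.
Proof.
move=> us s_pure D Dk c Pc dc _.
pose Red (s : seq 'I_N) (p : V) := {in msupp (mpoly_of_veronese p),
  forall m, {in s, forall j, ~~ (exponent j <= m)%MM}}.
(* Degrees are congruent to [k] modulo [d] and [D] misses [k], so the next possible value is k + d.
   This also keeps quotients by an x_a^d inside the module. *)
have lt_k (p : V) m : vhomog D p -> m \in msupp (mpoly_of_veronese p) ->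
    (k + d <= mdeg m)%N.
  move=> Pp pm; have [km dm] := mem_veronese pm.
  have := Pp m pm; move: km; rewrite leq_eqVlt => /predU1P[<-|lt_k _].
    by rewrite (negPf Dk).
  by rewrite -leq_subRL ?(ltnW lt_k) // dvdn_leq // subn_gt0.
have [||||c' [v [Pc' Pv Rv def_c]]] :=
  @koszul_regular _ _ _ _ _ graded_veronese pure_var Red D _ _ _ s c us _ Pc dc.
- by [].
- move=> i s' v _ Pv Rv.
  have vw : mquo (exponent i) (mpoly_of_veronese v) \in veronese_pred d k.
    apply/allP => m /msupp_quo vm; have [_] := mem_veronese vm.
    have := lt_k _ _ Pv vm; rewrite mdegD mdeg_exponent addnC leq_add2l => le_k.
    by rewrite le_k -addnBA // dvdn_addr.
  exists (veronese_filter (fun m => ~~ (exponent i <= m)%MM) v).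
  exists (Veronese vw); split.
  + apply: val_inj; rewrite [val _](mquoE (exponent i)).
    by have /= <- := veronese_scaleX i (Veronese vw).
  + by move=> m; rewrite msupp_filter => /andP[_ /Pv].
  + move=> m; rewrite msupp_filter => /andP[im vm] j.
    by rewrite inE => /predU1P[->//|]; apply: Rv.
  + by move=> m /msupp_quo/Pv; rewrite mdegD mdeg_exponent addnC.
- move=> i s' v w /existsP[a /eqP ei] /allP s'_pure i_s' Rv def_v; apply: val_inj.
  apply: (@mpolyX_regular _ _ _ (@exponent n d) i s' _
    (fun j => mpoly_of_veronese (w j))).
  (* Powers of distinct variables are coprime, and equal variables would give j = i. *)
  + move=> j js m; have /existsP[b /eqP ej] := s'_pure j js.
    rewrite ej ei !mnm_le_pure mnmDE mulmnE mnm1E.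
    have [ab|//] := eqVneq a b; rewrite ab -ej in ei.
    by rewrite (exponent_inj ei) js in i_s'.
  + by move=> m vm j; apply: Rv.
  + rewrite -veronese_scaleX def_v.
    rewrite (big_morph (@mpoly_of_veronese K n d k) (id1 := 0) (op1 := +%R)) //.
    by apply: eq_bigr => j _; rewrite veronese_scaleX.
- by apply/allP => i; rewrite s_pure.
exists c' => //; rewrite def_c; suff -> : v = 0 by rewrite kbase0 addr0.
apply: val_inj; apply/mpolyP => m; rewrite mcoeff0.
have [vm|/memN_msupp_eq0//] := boolP (m \in msupp (mpoly_of_veronese v)).
have := leq_trans k_large (lt_k _ _ Pv vm); rewrite ltnNge mdegE => /negP[].
rewrite -[n in (n * _)%N]card_ord -sum_nat_const; apply: leq_sum => a _.
have [i ei] := exponent_pure a.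
have := Rv m vm i; rewrite s_pure ei mnm_le_pure => /(_ _).
rewrite -ltnNge -[X in (_ < X)%N](prednK d_gt0) ltnS; apply.
by apply/existsP; exists a; rewrite ei.
Qed.

Lemma veronese_on_strand : exists s : seq 'I_N,
  [/\ uniq s, s =i 'I_N & on_strand d vhomog (fun=> True) s k].
Proof.
(* The pure powers form the tail of the list because [on_strand_cat] adds variables in front. *)
pose A i := ~~ pure_var i.
exists ([seq i <- enum 'I_N | A i] ++ [seq i <- enum 'I_N | predC A i]).
have perm_s := permEl (perm_filterC A (enum 'I_N)).
rewrite (perm_uniq perm_s) enum_uniq.
split=> // [i|]; first by rewrite (perm_mem perm_s) mem_enum.
apply: (on_strand_cat graded_veronese); apply: on_strand_pure.
  by rewrite filter_uniq ?enum_uniq.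
by move=> i; rewrite mem_filter mem_enum andbT /= negbK.
Qed.

End VeroneseStrand.

(** * Degree-preserving maps out of free modules *)

Section GradedMaps.
Variables (K : fieldType) (N d : nat) (V : lmodType {mpoly K[N]}).
Notation R := {mpoly K[N]}.
Variables (P : (nat -> bool) -> V -> Prop).
Hypothesis gP : graded_module d P.

Lemma gm_sum (I : Type) (r : seq I) (F : I -> V) D :
  (forall i, P D (F i)) -> P D (\sum_(i <- r) F i).
Proof.
by move=> PF; elim/big_ind: _ => [|u v|//]; [apply: (gm0 gP) | apply: (gmD gP)].
Qed.

Lemma gm_monomial m D v : P (fun n => D (n + d * mdeg m)%N) v -> P D ('X_[m] *: v).
Proof.
elim: {m}(mdeg m) {-2}m (erefl (mdeg m)) D v => [|e IHe] m def_e D v Pv.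
  have /eqP-> : m == 0%MM by rewrite -mdeg_eq0 def_e.
  rewrite mpolyX0 scale1r; apply: gm_sub gP _ _ _ _ Pv => n.
  by rewrite def_e muln0 addn0.
have [i mi] : exists i, m i != 0%N.
  apply/existsP; rewrite -negb_forall; apply/negP => /forallP m0.
  by move: def_e; rewrite mdegE big1 // => i _; apply/eqP.
have def_m : m = (U_(i) + (m - U_(i)))%MM by rewrite addmC submK ?lep1mP.
rewrite def_m mpolyXD -scalerA; apply: (gmX gP); apply: IHe.
  by apply/eqP; rewrite -eqSS -def_e [in X in _ == X]def_m mdegD mdeg1.
apply: gm_sub gP _ _ _ _ Pv => n; rewrite def_e.
have -> : mdeg (m - U_(i))%MM = e.
  by apply/eqP; rewrite -eqSS -def_e [in X in _ == X]def_m mdegD mdeg1.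
by rewrite mulnS addnAC addnA.
Qed.

Lemma gm_linear b (sh : 'I_b -> nat) (f : {linear 'rV[R]_b -> V}) :
    (forall l, P (pred1 (sh l)) (f (delta_mx 0 l))) ->
  forall D v, fhomog d sh D v -> P D (f v).
Proof.
move=> Pf D v hv; rewrite [v]row_sum_delta raddf_sum; apply: gm_sum => l /=.
rewrite linearZ /= [v 0 l]mpolyE scaler_suml big_seq_cond.
elim/big_ind: _ => [||m]; [exact: (gm0 gP) | exact: (gmD gP) | ].
rewrite andbT => vm; rewrite -mul_mpolyC -scalerA; apply: (gmC gP).
apply: gm_monomial; apply: gm_sub gP _ _ _ _ (Pf l) => n /eqP->.
by rewrite addnC; apply: hv vm.
Qed.

(** Keep the part of the preimage with degrees in [D]: the error then has all its degrees in [D] and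
    all outside [D], so it is zero. *)
Lemma gm_lift b (sh : 'I_b -> nat) (f : {linear 'rV[R]_b -> V}) :
    (forall l, P (pred1 (sh l)) (f (delta_mx 0 l))) ->
  forall D x w, P D x -> x = f w -> exists2 v, fhomog d sh D v & x = f v.
Proof.
move=> Pf D x w Px def_x; have gF := @graded_free K N d b sh.
have [u [v [def_w hu hv]]] := gm_split gF D (v := w) (D := predT) (fun _ _ _ => isT).
exists u => //; apply/eqP; rewrite -subr_eq0; apply/eqP; apply: (gm_disj gP (D := D)).
  by apply: (gmB gP) => //; apply: (gm_linear Pf).
by rewrite def_x def_w raddfD addrAC subrr add0r; apply: (gm_linear Pf).
Qed.

End GradedMaps.

(** The kernel of the map leaving F_i, with the augmentation treated as the differential out of
    F_0. *)
Definition res_cycles (K : fieldType) (N : nat) (M : lmodType {mpoly K[N]})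
    (F : augmented_complex M) i : 'rV[{mpoly K[N]}]_(rk F i) -> Prop :=
  match i return 'rV_(rk F i) -> Prop with
  | 0%N => fun v => aug F v = 0
  | i'.+1 => fun v => v *m diff F i' = 0
  end.

(** * Betti numbers of arbitrary graded free resolutions *)

Section Resolution.
Variables (K : fieldType) (N d k : nat) (M : lmodType {mpoly K[N]}).
Notation R := {mpoly K[N]}.
Variables (P : (nat -> bool) -> M -> Prop) (gr : nat -> pred M) (s : seq 'I_N).
Hypotheses (gP : graded_module d P) (us : uniq s) (sT : s =i 'I_N).
Hypothesis gr_homog : forall j x, gr j x -> P (pred1 j) x.
Hypothesis strM : on_strand d P (fun=> True) s k.
Variable F : augmented_complex M.
Hypothesis resF : graded_free_resolution d gr F.

Let exactness i v : @res_cycles _ _ _ F i v <-> exists w, v = w *m diff F i.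
Proof.
case: resF => _ [_ ex0 exS]; case: i v => [|i] v; [exact: ex0|exact: exS].
Qed.

Let aug_graded l : P (pred1 (sh l)) (aug F (delta_mx 0 l)).
Proof. by have [[/(_ l)/gr_homog]] := resF. Qed.

Let diff_graded i l :
  fhomog d (@sh _ _ _ F i) (pred1 (sh l)) (mulmxr (diff F i) (delta_mx 0 l)).
Proof.
rewrite /= -rowE => l' m; have [[_ /(_ i l l' m) h] _] := resF.
by move=> /h /= ->.
Qed.

Let diff_cyc i (v : 'rV[R]_(rk F i.+1)) : res_cycles (v *m diff F i).
Proof. by apply/exactness; exists v. Qed.

(** Dimension shifting along the resolution: each syzygy module moves the strand by [d]. *)
Lemma on_strand_resolution i :
  on_strand d (fun D v => fhomog d (@sh _ _ _ F i) D v /\ res_cycles v)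
    (@in_max _ _ _) s (k + i.+1 * d)%N.
Proof.
elim: i => [|i IHi].
  rewrite mul1n; apply: (on_strand_syzygy us sT _ strM) => // [|D x Px].
    exact: (gm_linear gP aug_graded).
  have [_ [/(_ x)[w def_x] _ _]] := resF.
  exact: (gm_lift gP aug_graded Px (esym def_x)).
have -> : (k + i.+2 * d = k + i.+1 * d + d)%N by lia.
(* The target is F_i with its predicate cut down to the syzygies, onto which F_(i+1) maps by
   exactness. *)
apply: (on_strand_syzygy (f := mulmxr (diff F i)) us sT _ IHi).
- exact: in_max0.
- move=> D v hv; split; last exact: diff_cyc.
  exact: (gm_linear (@graded_free _ _ _ _ _) (@diff_graded i)).
- move=> D x [hx /exactness[w def_x]].
  exact: (gm_lift (@graded_free _ _ _ _ _) (@diff_graded i) hx def_x).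
Qed.

(** A cycle is a boundary, and reducing it modulo the variables leaves exactly [v]. *)
Let cyc_tens i (v : 'rV[K]_(rk F i)) (u : 'I_N -> 'rV[R]_(rk F i)) :
  res_cycles (map_mx (@mpolyC N K) v - \sum_(a <- s) 'X_a *: u a) ->
  (v <= tens F i)%MS.
Proof.
move=> /exactness[w def_w]; apply/submxP; exists (map_mx (mcoeff 0%MM) w).
rewrite -map_mxM -def_w map_mxB; apply/rowP => l.
rewrite !mxE /= mpolyCK summxE raddf_sum big1 ?subr0 // => a _.
by rewrite /= mxE mcoeffXM lep1mP mnm0E.
Qed.

(** Lift [v] to a constant vector. Its image one step down is a syzygy off the strand, lying in (y)F
    when i > 0 because [v] is a cycle; hence it is a combination of the y_a with syzygy coefficients
    (elements of M when i = 0). Lifting these coefficients corrects the constant vector to a true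
    cycle. *)
Lemma tens_cycles_off_strand i j (v : 'rV[K]_(rk F i)) :
    j != (k + i * d)%N -> (forall l, sh l != j -> v 0 l = 0) ->
  (v <= tens_cycles F i)%MS -> (v <= tens F i)%MS.
Proof.
move=> nj hv.
have hV : fhomog d (@sh _ _ _ F i) (pred1 j) (map_mx (@mpolyC N K) v).
  move=> l m; rewrite mxE msuppC; have [//|nz] := eqVneq (v 0 l) 0.
  rewrite inE => /eqP->; rewrite mdeg0 muln0 /=.
  by apply: contraNT nz => /hv->.
case: i v nj hv hV => [|i] v nj hv hV cv.
  have jk : ~~ pred1 j k by rewrite /= eq_sym -[k]addn0.
  have [w [_ def_w]] :=
    on_strand_generated (gm0 gP) us strM jk (gm_linear gP aug_graded hV) I.
  have /fin_all_exists[u def_u] (a : 'I_N) : exists u, aug F u = w a.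
    by have [_ [/(_ (w a))]] := resF.
  apply: (@cyc_tens 0 v u) => /=; rewrite raddfB raddf_sum /= def_w.
  by apply/eqP; rewrite subr_eq0; apply/eqP/eq_bigr => a _; rewrite linearZ /= def_u.
set V := map_mx _ v in hV.
have PV : fhomog d (@sh _ _ _ F i) (pred1 j) (V *m diff F i).
  exact: (gm_linear (@graded_free _ _ _ _ _) (@diff_graded i) hV).
have mV : in_max (V *m diff F i).
  have VK : map_mx (mcoeff 0%MM) V = v.
    by apply/rowP => l; rewrite !mxE /= mpolyCK.
  by move=> l; have /sub_kermxP/rowP/(_ l) := cv; rewrite -{1}VK -map_mxM !mxE.
have [||w [Pw def_w]] :=
  on_strand_generated _ us (@on_strand_resolution i) _ (conj PV (diff_cyc V)) mV.
- move=> D; split; first exact: (gm0 (@graded_free _ _ _ _ _)).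
  by apply/exactness; exists 0; rewrite mul0mx.
- by rewrite /= eq_sym.
have /fin_all_exists[u def_u] (a : 'I_N) : exists u, w a = u *m diff F i.
  by have [_ /exactness] := Pw a.
apply: (@cyc_tens i.+1 v u) => /=; rewrite mulmxBl def_w mulmx_suml.
apply/eqP; rewrite subr_eq0; apply/eqP/eq_bigr => a _.
by rewrite def_u -scalemxAl.
Qed.

(** As [betti] is a truncated difference of ranks, it suffices that the cycles of degree [j] are
    boundaries. *)
Lemma betti_off_strand i j : j != (k + i * d)%N -> betti F i j = 0%N.
Proof.
move=> nj; apply/eqP; rewrite subn_eq0; apply: mxrankS.
apply/row_subP => r; rewrite sub_capmx; set v := row r _.
have: (v <= tens_cycles F i :&: degree_part F i j)%MS by apply: row_sub.
rewrite sub_capmx => /andP[cv dv]; rewrite dv andbT.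
apply: tens_cycles_off_strand nj _ cv => l nl.
have /submxP[u ->] := dv.
by rewrite mul_mx_diag !mxE (negPf nl) mulr0.
Qed.

Lemma total_betti_on_strand i : total_betti F i = betti F i (k + i * d).
Proof.
have [lt_b|ge_b] := ltnP (k + i * d) (\max_(l < rk F i) sh l).+1.
  rewrite /total_betti (bigD1 (Ordinal lt_b)) //= big1 ?addn0 // => j nj.
  by apply: betti_off_strand.
(* Here the strand degree exceeds every generator degree, so the sum skips it; the degree part is
   then zero and both sides vanish. *)
rewrite /total_betti big1 => [|j _]; last first.
  by apply: betti_off_strand; rewrite neq_ltn (leq_trans (ltn_ord j)).
rewrite /betti; suff -> : degree_part F i (k + i * d) = 0.
  by rewrite !capmx0 !mxrank0.
apply/matrixP => l l'; rewrite !mxE [_ == _]negbTE ?mul0rn //.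
by rewrite neq_ltn (leq_trans _ ge_b) // ltnS leq_bigmax.
Qed.

(** Minimality makes the tensored differentials zero, so each basis vector is a cycle; off the
    strand it would be a boundary, hence zero. *)
Lemma minimal_pure : (0 < d)%N -> minimal F -> pure F.
Proof.
move=> d_gt0 minF; exists (fun i => k + i * d)%N; split=> [i l|i] /=; last first.
  by rewrite ltn_add2l mulSn -[X in (X < _)%N]add0n ltn_add2r.
have tens0 j : tens F j = 0 by apply/matrixP => a b; rewrite !mxE minF.
apply/eqP; apply: contraT => nl.
have: ((delta_mx 0 l : 'rV[K]_(rk F i)) <= tens F i)%MS.
  apply: (tens_cycles_off_strand nl) => [l' nl'|].
    rewrite mxE; have [ll'|_] := eqVneq l' l; last by rewrite andbF.
    by rewrite ll' eqxx in nl'.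
  case: i l {nl} => [|i] l; first exact: submx1.
  by rewrite /= tens0; apply/sub_kermxP; rewrite mulmx0.
case/submxP=> u; rewrite tens0 mulmx0 => /rowP/(_ l).
by rewrite !mxE !eqxx => /eqP; rewrite oner_eq0.
Qed.
End Resolution.

(** * Finite-dimensional K-subspaces of R-modules *)

Section FiniteBasis.
Variables (K : fieldType) (N : nat) (V : lmodType {mpoly K[N]}).
Implicit Types (e : seq V) (u v : V) (U : V -> Prop) (c : K).

(** Only an R-module structure is given, so scalars of K act as constant polynomials. *)
Fixpoint kspan e u :=
  if e is x :: e' then exists c, kspan e' (u - c%:MP *: x) else u = 0.

Lemma kspan0 e : kspan e 0.
Proof. by elim: e => //= x e IHe; exists 0; rewrite mpolyC0 scale0r subr0. Qed.

Lemma kspanD e c u v : kspan e u -> kspan e v -> kspan e (u + c%:MP *: v).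
Proof.
elim: e u v => [|x e IHe] u v /=; first by move=> -> ->; rewrite scaler0 addr0.
move=> [a Su] [b Sv]; exists (a + c * b).
have := IHe _ _ Su Sv; congr kspan.
by rewrite mpolyCD mpolyCM scalerBr scalerA scalerDl opprD addrACA.
Qed.

Lemma kspan_sum (I : Type) e (r : seq I) (c : I -> K) (b : I -> V) :
  (forall i, kspan e (b i)) -> kspan e (\sum_(i <- r) (c i)%:MP *: b i).
Proof.
move=> Sb; elim: r => [|i r IHr]; first by rewrite big_nil; apply: kspan0.
by rewrite big_cons addrC; apply: kspanD.
Qed.

Lemma kspan_map (I : Type) (r : seq I) (c : I -> K) (b : I -> V) :
  kspan [seq b i | i <- r] (\sum_(i <- r) (c i)%:MP *: b i).
Proof.
elim: r => [|i r IHr]; first by rewrite big_nil.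
by rewrite big_cons; exists (c i); rewrite addrAC subrr add0r.
Qed.

(** Induction on the spanning list: a basis of the part of U spanned by the tail is extended by one
    vector of U outside that span, if there is one. *)
Lemma finite_basis U e :
    (forall c u v, U u -> U v -> U (u + c%:MP *: v)) ->
    (forall u, U u -> kspan e u) ->
  exists q (b : 'I_q -> V),
    [/\ forall l, U (b l),
        forall c : 'I_q -> K, \sum_l (c l)%:MP *: b l = 0 -> forall l, c l = 0
      & forall u, U u -> exists c : 'I_q -> K, u = \sum_l (c l)%:MP *: b l].
Proof.
elim: e U => [|x e IHe] U UD Ue.
  exists 0%N, (fun=> 0); split=> [[]//|c _ []//|u /Ue->].
  by exists (fun=> 0); rewrite big_ord0.
have [||q [b [Ub free_b span_b]]] := IHe (fun u => U u /\ kspan e u).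
- by move=> c u v [Uu Su] [Uv Sv]; split; [apply: UD | apply: kspanD].
- by move=> u [].
have [[u0 [Uu0 nSu0]]|no_u0] := classic (exists u, U u /\ ~ kspan e u); last first.
  exists q, b; split=> [l|//|u Uu]; first by case: (Ub l).
  by apply: span_b; split=> //; apply: NNPP => nSu; apply: no_u0; exists u.
exists q.+1, (fun l => if unlift ord0 l is Some l' then b l' else u0).
have sumE (c : 'I_q.+1 -> K) :
    \sum_l (c l)%:MP *: (if unlift ord0 l is Some l' then b l' else u0) =
    (c ord0)%:MP *: u0 + \sum_l (c (lift ord0 l))%:MP *: b l.
  rewrite big_ord_recl unlift_none; congr (_ + _).
  by apply: eq_bigr => l _; rewrite liftK.
split=> [l|c|u Uu].
- by case: unliftP => [l'|] _ //; case: (Ub l').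
- rewrite sumE => c0; have [c00|nz] := eqVneq (c ord0) 0; last first.
    case: nSu0; have -> : u0 = 0 + (- (c ord0)^-1)%:MP *:
        \sum_l (c (lift ord0 l))%:MP *: b l.
      move/eqP: c0; rewrite addrC addr_eq0 => /eqP->.
      rewrite add0r scalerN -scaleNr -mpolyCN opprK scalerA -mpolyCM mulVf //.
      by rewrite scale1r.
    by apply: kspanD; [apply: kspan0 | apply: kspan_sum => l; case: (Ub l)].
  move: c0; rewrite c00 mpolyC0 scale0r add0r => /free_b c0 l.
  by case: (unliftP ord0 l) => [l'|] ->.
have [a Sa] := Ue u Uu; have [a0 Sa0] := Ue u0 Uu0.
have nz_a0 : a0 != 0.
  by apply/eqP => a00; case: nSu0; move: Sa0; rewrite a00 mpolyC0 scale0r subr0.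
(* The factor a / a0 cancels the coefficient of [x]. *)
have [|c def_u] := span_b (u + (- (a / a0))%:MP *: u0).
  split; first exact: UD.
  have := kspanD (- (a / a0)) Sa Sa0; congr kspan.
  rewrite scalerBr scalerA -mpolyCM mulNr divfK // !mpolyCN !scaleNr opprK.
  by rewrite addrACA addNr addr0.
exists (fun l => if unlift ord0 l is Some l' then c l' else a / a0).
rewrite sumE unlift_none; under eq_bigr do rewrite liftK.
by rewrite -def_u addrCA mpolyCN scaleNr subrr addr0.
Qed.

End FiniteBasis.

(** * Linear maps given by a finite family *)

Section LinearCombination.
Variables (K : fieldType) (N q : nat) (V : lmodType {mpoly K[N]}) (b : 'I_q -> V).
Notation R := {mpoly K[N]}.

Definition lincomb (w : 'rV[R]_q) := \sum_l w 0 l *: b l.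

Fact lincomb_is_linear : linear lincomb.
Proof.
move=> r u v; rewrite /lincomb scaler_sumr -big_split; apply: eq_bigr => l _ /=.
by rewrite !mxE scalerDl scalerA.
Qed.

HB.instance Definition _ :=
  GRing.isLinear.Build R 'rV[R]_q V _ lincomb lincomb_is_linear.

Lemma lincomb_delta l : lincomb (delta_mx 0 l) = b l.
Proof.
rewrite /lincomb (bigD1 l) //= big1 => [|l' nl]; rewrite !mxE ?eqxx.
  by rewrite scale1r addr0.
by rewrite (negPf nl) scale0r.
Qed.

End LinearCombination.

(** * Minimal free covers by graded Nakayama *)

Section Cover.
Variables (K : fieldType) (N d : nat).
Notation R := {mpoly K[N]}.

(** If two parts of an element with complementary degrees have images summing to zero, each image
    vanishes by [gm_disj], so the kernel contains the parts. *)
Lemma graded_ker (U V : lmodType R) P P' (f : {linear U -> V}) :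
    graded_module d P -> graded_module d P' ->
    (forall D u, P D u -> P' D (f u)) ->
  graded_module d (fun D u => P D u /\ f u = 0).
Proof.
move=> gP gP' Pf; split.
- by move=> D; rewrite raddf0; split=> //; apply: (gm0 gP).
- move=> D u v [Pu fu] [Pv fv]; rewrite raddfB /= fu fv subr0.
  by split=> //; apply: (gmB gP).
- move=> D i v [Pv fv]; rewrite linearZ /= fv scaler0.
  by split=> //; apply: (gmX gP).
- move=> D c v [Pv fv]; rewrite linearZ /= fv scaler0.
  by split=> //; apply: (gmC gP).
- move=> D E v [Pv fv]; have [u [w [def_v Pu Pw]]] := gm_split gP E Pv.
  have fuw : f u = - f w.
    by move: fv; rewrite def_v raddfD => /eqP; rewrite addr_eq0 => /eqP.
  have fu : f u = 0.
    apply: (gm_disj gP') (Pf _ _ Pu) _; rewrite fuw; apply: (gmN gP').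
    by apply: (gm_sub gP') (Pf _ _ Pw) => n /andP[_ /negPf->]; rewrite andbF.
  by exists u, w; split=> //; split=> //; apply/eqP; rewrite -oppr_eq0 -fuw fu.
- by move=> D v [Pv _] [Pv' _]; apply: (gm_disj gP) Pv Pv'.
- by move=> D v [Pv fv]; have [n Pn] := gm_bound gP Pv; exists n.
- by move=> D E v DE [Pv fv]; split=> //; apply: (gm_sub gP) DE Pv.
Qed.

Variables (V : lmodType R) (P : (nat -> bool) -> V -> Prop) (Q : V -> Prop).
Variables (s : seq 'I_N) (t : nat) (e : seq V).
Hypotheses (d_gt0 : (0 < d)%N) (us : uniq s) (sT : s =i 'I_N).
Hypotheses (gP : graded_module d P) (QP : forall v, P predT v -> Q v).
Hypothesis (strP : on_strand d P Q s t).
Hypothesis (Pe : forall v, P (pred1 t) v -> kspan e v).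

(** A K-basis of the degree [t] part generates, because everything off degree [t] lies in (y)V.
    Constant terms of a relation give a K-linear relation in degree [t], so they vanish. *)
Lemma minimal_cover : exists q (b : 'I_q -> V),
  [/\ forall l, P (pred1 t) (b l),
      forall v, P predT v -> exists w, v = lincomb b w,
      forall w, lincomb b w = 0 -> in_max w,
      graded_module d (fun D w => fhomog d (fun=> t) D w /\ lincomb b w = 0)
    & on_strand d (fun D w => fhomog d (fun=> t) D w /\ lincomb b w = 0)
        (@in_max _ _ _) s (t + d)%N].
Proof.
have [c u v Pu Pv|q [b [Pb free_b span_b]]] := finite_basis _ Pe.
  by apply: (gmD gP) => //; apply: (gmC gP).
have gF := @graded_free K N d q (fun=> t).
have Pf D w : fhomog d (fun=> t) D w -> P D (lincomb b w).
  by apply: (gm_linear gP) => l; rewrite /= lincomb_delta.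
(* Induction on a degree bound: past the degree [t] part, the coefficients of the variables have
   degrees lower by d > 0. *)
have span_lt n v : P (fun j => j < n)%N v -> exists w, v = lincomb b w.
  elim: n v => [|n IHn] v Pv.
    exists 0; rewrite raddf0; apply: (gm_disj gP Pv).
    by apply: (gm_sub gP) Pv.
  have [u [w [-> Pu Pw]]] := gm_split gP (pred1 t) Pv.
  have [|c def_u] := span_b u; first by apply: (gm_sub gP) Pu => j /andP[].
  have Pt : ~~ ((t < n.+1)%N && ~~ pred1 t t) by rewrite /= eqxx andbF.
  have [|x [Px def_w]] := on_strand_generated (gm0 gP) us strP Pt Pw.
    by apply: QP; apply: (gm_sub gP) Pw.
  have /fin_all_exists[y def_x] (i : 'I_N) : exists y, x i = lincomb b y.
    apply: IHn; apply: (gm_sub gP) (Px i) => j /andP[lt_jd _].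
    by rewrite -ltnS (leq_trans _ lt_jd) // ltnS -[X in (X < _)%N]addn0 ltn_add2l.
  exists (\row_l (c l)%:MP + \sum_(i <- s) 'X_i *: y i).
  rewrite raddfD raddf_sum /= def_u def_w; congr (_ + _).
    by apply: eq_bigr => l _; rewrite mxE.
  by apply: eq_bigr => i _; rewrite linearZ /= def_x.
have span v : P predT v -> exists w, v = lincomb b w.
  move=> /(gm_bound gP)[n Pn]; apply: (span_lt n).
  by apply: (gm_sub gP) Pn => j /andP[].
exists q, b; split=> // [w fw||].
- have [u [v [def_w hu hv]]] :=
    gm_split gF (pred1 t) (v := w) (D := predT) (fun _ _ _ => isT).
  have fuv : lincomb b u = - lincomb b v.
    by move: fw; rewrite def_w raddfD => /eqP; rewrite addr_eq0 => /eqP.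
  have fu : lincomb b u = 0.
    apply: (gm_disj gP) (Pf _ _ hu) _; rewrite fuv; apply: (gmN gP).
    by apply: (gm_sub gP) (Pf _ _ hv).
  (* With generators in degree [t] and d > 0, entries of degree [t] are constants. *)
  have def_u l : u 0 l = ((u 0 l)@_0%MM)%:MP.
    apply/mpolyP => m; rewrite mcoeffC.
    have [->|nz] := eqVneq m 0%MM; first by rewrite mulr1.
    rewrite mulr0; apply: memN_msupp_eq0; apply/negP => /hu /=.
    rewrite -[X in _ == X]add0n eqn_add2r muln_eq0 mdeg_eq0 (negPf nz).
    by rewrite eqn0Ngt d_gt0.
  move=> l; rewrite def_w mxE mcoeffD.
  have -> : (u 0 l)@_0%MM = 0.
    apply: (free_b (fun l => (u 0 l)@_0%MM)); rewrite -[RHS]fu.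
    by apply: eq_bigr => l' _; rewrite -def_u.
  rewrite add0r; apply: memN_msupp_eq0; apply/negP => /hv /=.
  by rewrite mdeg0 muln0 eqxx.
- exact: (@graded_ker _ _ _ P (lincomb b)).
- apply: (on_strand_syzygy us sT _ strP) => // [|D x Px].
    by apply: QP; apply: (gm0 gP).
  have [|w def_x] := span x; first by apply: (gm_sub gP) Px.
  by apply: (gm_lift gP _ Px def_x) => l; rewrite /= lincomb_delta.
Qed.

End Cover.

(** The default 0 covers monomials outside the module, which get coefficient 0 in
    [veronese_span]. *)
Definition veronese_monomial (K : fieldType) (n d k : nat) (m : 'X_{1..n}) :
  veronese K n d k := insubd 0 'X_[m].

Lemma veronese_span (K : fieldType) (n d k : nat) (p : veronese K n d k) :
    vhomog (pred1 k) p ->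
  kspan [seq veronese_monomial K d k (bmnm m)
        | m <- index_enum 'X_{1..n < k.+1}] p.
Proof.
move=> hp.
have -> : p = \sum_(m : 'X_{1..n < k.+1})
    (mcoeff m (mpoly_of_veronese p))%:MP *: veronese_monomial K d k m;
  last exact: kspan_map.
apply: val_inj => /=.
rewrite (big_morph (@mpoly_of_veronese K n d k) (id1 := 0) (op1 := +%R)) //.
rewrite [LHS](@mpolywE _ _ k.+1); last first.
  by rewrite msizeE; apply/bigmax_leqP_seq => m /hp /eqP->.
apply: eq_bigr => m _; rewrite veronese_scaleC.
have [pm|/memN_msupp_eq0->] := boolP (bmnm m \in msupp (mpoly_of_veronese p)).
  congr (_ *: _); apply/esym/insubdK.
  apply/allP => m'; rewrite msuppX inE => /eqP->.
  by rewrite (eqP (hp _ pm)) leqnn subnn dvdn0.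
by rewrite !scale0r.
Qed.

(** * Construction of a minimal resolution *)

Section Existence.
Variables (K : fieldType) (N d k : nat) (M : lmodType {mpoly K[N]}).
Notation R := {mpoly K[N]}.

(** As d > 0, the entries are linear forms; this supplies the finite spanning list for the next
    cover. *)
Lemma linear_part_span q t (w : 'rV[R]_q) : (0 < d)%N ->
    fhomog d (fun=> t) (pred1 (t + d)%N) w ->
  kspan [seq 'X_x.2 *: delta_mx 0 x.1 | x <- index_enum {: 'I_q * 'I_N}] w.
Proof.
move=> d_gt0 hw.
have -> : w = \sum_(x : 'I_q * 'I_N)
    (mcoeff U_(x.2) (w 0 x.1))%:MP *: ('X_x.2 *: delta_mx 0 x.1);
  last exact: kspan_map.
rewrite {1}[w]row_sum_delta -(pair_big predT predT (fun l a =>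
  (mcoeff U_(a) (w 0 l))%:MP *: ('X_a *: delta_mx 0 l))) /=.
apply: eq_bigr => l _; under [RHS]eq_bigr do rewrite scalerA.
rewrite -scaler_suml; congr (_ *: _); apply/mpolyP => m; rewrite raddf_sum /=.
under eq_bigr do rewrite mcoeffCM mcoeffX.
have [/mdeg1P[i /eqP->]|nm] := boolP (mdeg m == 1%N).
  rewrite (bigD1 i) //= eqxx mulr1 big1 ?addr0 // => j nj.
  by rewrite eq_mnm1 (negPf nj) mulr0.
rewrite big1 => [|j _]; last first.
  by case: eqP => [ej|_]; [rewrite -ej mdeg1 in nm | rewrite mulr0].
apply: memN_msupp_eq0; apply/negP => /hw /=.
by rewrite addnC eqn_add2l -[X in _ == X]muln1 eqn_pmul2l // (negPf nm).
Qed.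

Variables (P : (nat -> bool) -> M -> Prop) (gr : nat -> pred M) (s : seq 'I_N).
Hypotheses (d_gt0 : (0 < d)%N) (us : uniq s) (sT : s =i 'I_N).
Hypotheses (gP : graded_module d P) (P_total : forall x, P predT x).
Hypothesis homog_gr : forall j x, P (pred1 j) x -> gr j x.
Hypothesis strM : on_strand d P (fun=> True) s k.
Variable e : seq M.
Hypothesis Pe : forall x, P (pred1 k) x -> kspan e x.

(** Ranks are only found during the construction, so each stage packs its rank with the predicate
    defining the syzygies. *)
Let submod := {q : nat & 'rV[R]_q -> Prop}.

Let syzygy_inv i (Z : submod) :=
  [/\ graded_module d
        (fun D w => fhomog d (fun=> (k + i * d)%N) D w /\ projT2 Z w),
      forall w, projT2 Z w -> in_max w
    & on_strand d (fun D w => fhomog d (fun=> (k + i * d)%N) D w /\ projT2 Z w)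
        (@in_max _ _ _) s (k + i.+1 * d)%N].

Let syzygies (V : lmodType R) q (b : 'I_q -> V) : submod :=
  existT _ q (fun w => lincomb b w = 0).

Let covers i (Z : submod) (B : {q' & 'I_q' -> 'rV[R]_(projT1 Z)}) :=
  [/\ forall l,
        fhomog d (fun=> (k + i * d)%N) (pred1 (k + i.+1 * d)%N) (projT2 B l),
      forall w, projT2 Z w <-> exists w', w = lincomb (projT2 B) w'
    & syzygy_inv i.+1 (syzygies (projT2 B))].

(** The implication stands under the existential so that a choice function can be defined for every
    [Z], before the invariant is established. *)
Let next_step i Z : exists B, syzygy_inv i Z -> @covers i Z B.
Proof.
have [inv|] := classic (syzygy_inv i Z); last by exists (existT _ 0%N (fun=> 0)).
case: Z inv => q Z [/= gZ mZ strZ].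
have [w []|w [hw _]|q' [b [Pb span_b min_b gb strb]]] :=
    minimal_cover d_gt0 us sT gZ _ strZ _
      (e := [seq 'X_x.2 *: delta_mx 0 x.1 | x <- index_enum {: 'I_q * 'I_N}]).
- by move=> _ /mZ.
- apply: (@linear_part_span q (k + i * d)%N) => //.
  by rewrite (_ : k + i * d + d = k + i.+1 * d)%N //; lia.
exists (existT _ q' b) => _; split=> /= [l|w|].
- by case: (Pb l).
- split=> [Zw|[w' ->]]; first by apply: span_b; split.
  have [] // := gm_linear gZ (f := lincomb b) (sh := fun=> (k + i.+1 * d)%N)
    (D := predT) (v := w') _ (fun _ _ _ => isT).
  by move=> l; rewrite /= lincomb_delta.
- split=> //=.
  by rewrite (_ : k + i.+2 * d = k + i.+1 * d + d)%N //; lia.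
Qed.

Lemma exists_minimal_resolution :
  exists F : augmented_complex M, minimal_graded_free_resolution d gr F.
Proof.
have [q0 [b0 [Pb0 span_b0 min_b0 gb0 strb0]]] :=
  minimal_cover d_gt0 us sT gP (fun _ _ => I) strM Pe.
pose nxt i Z := sval (constructive_indefinite_description _ (next_step i Z)).
have nxtP i Z : syzygy_inv i Z -> covers i (nxt i Z).
  exact: (svalP (constructive_indefinite_description _ (next_step i Z))).
pose Z_ := nat_rect (fun=> submod) (syzygies b0)
  (fun i Z => syzygies (projT2 (nxt i Z))).
have invZ i : syzygy_inv i (Z_ i).
  elim: i => [|i IHi]; last by case: (nxtP _ _ IHi).
  by split=> /=; rewrite ?mul0n ?mul1n ?addn0.
pose F := @AugmentedComplex K N M
  (fun i => projT1 (Z_ i)) (fun i _ => (k + i * d)%N)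
  (fun i => \matrix_l projT2 (nxt i (Z_ i)) l) (lincomb b0).
have diffE i (w : 'rV[R]_(rk F i.+1)) :
    w *m diff F i = lincomb (projT2 (nxt i (Z_ i))) w.
  by rewrite mulmx_sum_row; apply: eq_bigr => l _; rewrite rowK.
exists F; split; first split; first split.
- by move=> l; apply: homog_gr; rewrite /= lincomb_delta mul0n addn0.
- move=> i l; rewrite rowK => l' m vm.
  by apply/eqP; have [/(_ l l' m vm)] := nxtP i _ (invZ i).
- split=> [x|v|i v]; first by have [w ->] := span_b0 x (P_total x); exists w.
  + have [_ /(_ v) Zv _] := nxtP 0%N _ (invZ 0%N).
    split=> [fv|[w def_v]].
      by have [w ->] := proj1 Zv fv; exists w; rewrite diffE.
    by apply: (proj2 Zv); exists w; rewrite def_v diffE.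
  + have [_ /(_ v) Zv _] := nxtP i.+1 _ (invZ i.+1); rewrite diffE.
    split=> [fv|[w def_v]].
      by have [w ->] := proj1 Zv fv; exists w; rewrite diffE.
    by apply: (proj2 Zv); exists w; rewrite def_v diffE.
(* Rows of the differential are syzygies of the previous cover, hence have no constant terms. *)
move=> i l l'; rewrite mxE.
have [_ exZ _] := nxtP i _ (invZ i); have [_ mZ _] := invZ i.
apply: mZ; apply/exZ; exists (delta_mx 0 l).
by rewrite lincomb_delta.
Qed.

End Existence.

Theorem proposition3p7 (K : fieldType) (n d k : nat) (hn : (1 <= n)%N)
    (hd : (1 <= d)%N) (hk : (d%:Z * (n%:Z - 1) - n%:Z < k%:Z)%R) :
  has_pseudo_linear_resolution d (@veronese_grading K n d k) k.
Proof.
(* Adding [d] to the bound on [k] gives k + d > dn - n = n(d - 1), where [d.-1] is a true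
   predecessor as d is positive. *)
have k_large : (n * d.-1 < k + d)%N by nia.
have [s [us sT strM]] := veronese_on_strand K hd k_large.
have gM := @graded_veronese K n d k.
have gr_homog j (p : veronese K n d k) : veronese_grading j p -> vhomog (pred1 j) p.
  by move=> /dhomogP hp m /hp /= ->.
split.
- apply: (exists_minimal_resolution hd us sT gM _ _ strM).
  + by [].
  + by move=> j p hp; apply/dhomogP => m /hp /eqP.
  + exact: veronese_span.
- by move=> F [resF minF]; apply: (minimal_pure gM us sT gr_homog strM resF).
- by move=> F resF i; apply: (total_betti_on_strand gM us sT gr_homog strM resF).
Qed.
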